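(* For any real $s>0$ and any $\delta$ with $N^{-3/(6+2s)}\le\delta\le1$, we have $$I^{\sharp}_{s,2}(\delta;N)\le\delta^2N^{2s(1-3/(6+2s))+o(1)}.$$
   Context: For integers $d,N\ge1$ and $\mathbf x=(x_1,\dots,x_d)\in\mathsf T_d=[0,1)^d$ (identified with $(\mathbb R/\mathbb Z)^d$), let $S_d(\mathbf x;N)=\sum_{n=1}^N\exp\bigl(2\pi i(x_1n+\dots+x_dn^d)\bigr)$. For real $s>0$, $\delta\in(0,1]$ and $\boldsymbol\xi\in\mathsf T_d$, let $I_{s,d}(\delta,\boldsymbol\xi;N)=\int_{\boldsymbol\xi+[0,\delta]^d}|S_d(\mathbf x;N)|^{2s}d\mathbf x$ (the integrand is 1-periodic in each coordinate), and $I^\sharp_{s,d}(\delta;N)=\sup_{\boldsymbol\xi\in\mathsf T_d}I_{s,d}(\delta,\boldsymbol\xi;N)$. A bound $X\le N^{c+o(1)}$ means: for every $\varepsilon>0$ there is $N_0$ depending only on $\varepsilon,s$ such that $X\le N^{c+\varepsilon}$ for all $N\ge N_0$, uniformly in $\delta$. *)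

(* Defs.v *)
From HB Require Import structures.
From mathcomp Require Import all_boot all_order all_algebra.
From mathcomp Require Import complex.
From mathcomp Require Import all_classical all_reals all_analysis.

Set Implicit Arguments.
Unset Strict Implicit.
Unset Printing Implicit Defensive.

Import Order.TTheory GRing.Theory Num.Theory.
Import numFieldNormedType.Exports.

Local Open Scope classical_set_scope.
Local Open Scope ring_scope.

Definition cexpi (R : realType) (t : R) : R[i] := Complex (cos t) (sin t).

(* The coordinates of x are indexed from 0, so that [tnth x j] multiplies
   n ^ (j + 1). *)
Definition weyl_sum (R : realType) (d : nat) (x : d.-tuple R) (N : nat) : R[i] :=
  \sum_(1 <= n < N.+1)
     cexpi (2 * pi * \sum_(j < d) tnth x j * n%:R ^+ j.+1).

(* The modulus [`|z|] of z : R[i] has type R[i]; its real part is the modulus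
   as an element of R. *)
Definition weyl_abs (R : realType) (d : nat) (x : d.-tuple R) (N : nat) : R :=
  complex.Re `|weyl_sum x N|.

Definition torus2 (R : realType) : set (R * R) :=
  `[0, 1[%classic `*` `[0, 1[%classic.

(* xi + [0, delta]^2, taken in R^2: the integrand below is 1-periodic in each
   coordinate, so no reduction modulo 1 is needed. *)
Definition box2 (R : realType) (delta : R) (xi : R * R) : set (R * R) :=
  `[xi.1, xi.1 + delta]%classic `*` `[xi.2, xi.2 + delta]%classic.

Definition local_mean_value2 (R : realType) (s delta : R) (xi : R * R)
    (N : nat) : \bar R :=
  (\int[(@lebesgue_measure R \x @lebesgue_measure R)%E]_(x in box2 delta xi)
     ((weyl_abs [tuple x.1; x.2] N) `^ (2 * s))%:E)%E.

Definition sup_mean_value2 (R : realType) (s delta : R) (N : nat) : \bar R :=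
  ereal_sup [set local_mean_value2 s delta xi N | xi in @torus2 R].

(* Main.v *)
(* Write S for the Weyl sum, eta = 3 / (6 + 2 s) < 1/2 and T = N^(1 - eta).
   For 2 s <= k one has |S|^(2 s) <= T^(2 s) + T^(2 s - k) |S|^k, so it suffices
   to bound the k-th moment over the box by delta^2 T^k N^o(1).

   - s <= 1, k = 2. Expanding the square, the box integral of the (n, m) term
     is at most delta^2 if n = m and 1 / (|n - m| |n^2 - m^2|) otherwise, so the
     second moment is at most delta^2 N + O(log^2 N), and delta^2 N >= 1.
   - 1 <= s <= 3, k = 6. The sixth moment over a unit box counts the solutions of
     n1 + n2 + n3 = m1 + m2 + m3, n1^2 + n2^2 + n3^2 = m1^2 + m2^2 + m3^2.
     These satisfy (n1 - m3) (n2 - m3) = (m1 - n3) (m2 - n3), and a b = c d is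
     parametrised by a = g x, b = y z, c = g y, d = x z; hence there are
     O(N^3 log^2 N) of them.
   - s >= 3. Here |S|^(2 s) <= N^(2 s - 6) |S|^6 and the sixth moment suffice.

   The inequalities between exponents follow from eta (6 + 2 s) = 3. *)

Require Import Defs.
From HB Require Import structures.
From mathcomp Require Import all_boot all_order all_algebra.
From mathcomp Require Import complex.
From mathcomp Require Import all_classical all_reals all_analysis.
From mathcomp Require Import measurable_realfun.
From mathcomp Require Import ring lra zify.
Import Order.TTheory GRing.Theory Num.Theory.
Import numFieldNormedType.Exports.
Local Open Scope classical_set_scope.
Local Open Scope ring_scope.

(** * Integrals of cosine sums over intervals and boxes *)

(* The modulus, up to sign, of the integral of [exp (i c x)] over an interval of
   length [delta]. *)
Definition sinc_weight {R : realType} (delta c : R) : R :=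
  if c == 0 then delta else 2 * sin (c * (delta / 2)) / c.

(** Centring the antiderivative at the midpoint turns the difference of two sines into a weight
    independent of [u] times a phase. Bounds on the weight are therefore uniform in the position of
    the box. *)
Lemma integral_cos_affine {R : realType} (u delta c phi : R) : 0 < delta ->
  (\int[lebesgue_measure]_(x in `[u, (u + delta)%R]) (cos (c * x + phi))%:E)%E =
  (sinc_weight delta c * cos (c * (u + delta / 2) + phi))%:E.
Proof.
move=> d0; rewrite /sinc_weight.
have ud : u < u + delta by rewrite ltrDl.
have [->|c0] := eqVneq c 0.
  under eq_integral do rewrite mul0r add0r.
  rewrite integral_cst//= lebesgue_measure_itv/= lte_fin ud mul0r add0r.
  by rewrite EFinM muleC -EFinD addrC addKr.
pose F x : R := sin (c * x + phi) / c.
have dF (x : R) : is_derive x 1 F (cos (c * x + phi)).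
  rewrite /F; apply: is_derive_eq.
  by rewrite /GRing.scale/= mulr0 add0r addr0 mulr1; field.
have cF (x : R) : {for x, continuous F}.
  by apply/differentiable_continuous/derivable1_diffP; exact: ex_derive.
rewrite (@continuous_FTC2 _ _ F)//.
- rewrite -EFinB /F; congr EFin.
  rewrite (_ : c * (u + delta) + phi = (c * (u + delta / 2) + phi) + c * (delta / 2)); last by field.
  rewrite (_ : c * u + phi = (c * (u + delta / 2) + phi) - c * (delta / 2)); last by field.
  by rewrite sinD sinB; field.
- apply: continuous_subspaceT => x.
  apply: continuous_comp; last exact: continuous_cos.
  apply: cvgD; last exact: cvg_cst.
  by apply: cvgMr; exact: cvg_id.
- split.
  + move=> x _; exact: ex_derive.
  + by apply: cvg_at_right_filter; exact: cF.
  + by apply: cvg_at_left_filter; exact: cF.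
- by move=> x _; rewrite derive1E; exact: derive_val.
Qed.

(** The amplitudes [k p] allow a second use: the weights produced by one integration become the
    amplitudes of the next. *)
Lemma integral_sum_cos_affine {R : realType} (P : finType) (k c phi : P -> R)
    (u delta : R) : 0 < delta ->
  (\int[lebesgue_measure]_(x in `[u, (u + delta)%R])
     (\sum_p k p * cos (c p * x + phi p))%:E)%E =
  (\sum_p k p * (sinc_weight delta (c p) * cos (c p * (u + delta / 2) + phi p)))%:E.
Proof.
move=> d0.
have intcos p : lebesgue_measure.-integrable `[u, u + delta]
    (EFin \o (fun x => cos (c p * x + phi p))).
  apply: continuous_compact_integrable; first exact: segment_compact.
  apply: continuous_subspaceT => x.
  apply: continuous_comp; last exact: continuous_cos.
  apply: cvgD; last exact: cvg_cst.
  by apply: cvgMr; exact: cvg_id.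
under eq_integral do rewrite -sumEFin.
under eq_integral do under eq_bigr do rewrite EFinM.
rewrite integral_sum//; last by move=> p; apply: integrableZl => //; exact: intcos.
rewrite -sumEFin; apply: eq_bigr => p _.
rewrite integralZl//; last exact: intcos.
by rewrite integral_cos_affine.
Qed.

Lemma measurable_box2 {R : realType} (delta : R) (xi : R * R) :
  measurable (box2 delta xi).
Proof. by apply: measurableX; exact: measurable_itv. Qed.

Lemma measurable_cos_affine2 {R : realType} (a b : R) :
  measurable_fun [set: R * R] (fun x : R * R => cos (a * x.1 + b * x.2)).
Proof.
apply: measurableT_comp.
  by apply: continuous_measurable_fun; exact: continuous_cos.
by apply: measurable_funD; apply: measurable_realfun.measurable_funM.
Qed.

(** Nonnegativity of the whole sum, which will be an even power of [weyl_abs], gives access to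
    Tonelli. The inner integral is over [x.2], with [al p * x.1] as phase. *)
Lemma integral_box2_sum_cos {R : realType} (P : finType) (al be : P -> R)
    (delta : R) (xi : R * R) : 0 < delta ->
  (forall x : R * R, 0 <= \sum_p cos (al p * x.1 + be p * x.2)) ->
  (\int[(@lebesgue_measure R \x @lebesgue_measure R)%E]_(x in box2 delta xi)
     (\sum_p cos (al p * x.1 + be p * x.2))%:E)%E =
  (\sum_p sinc_weight delta (be p) * (sinc_weight delta (al p) *
     cos (al p * (xi.1 + delta / 2) + be p * (xi.2 + delta / 2))))%:E.
Proof.
move=> d0 ge0.
pose f (x : R * R) := (\sum_p cos (al p * x.1 + be p * x.2))%:E.
have mf : measurable_fun [set: R * R] (f \_ (box2 delta xi)).
  apply: (measurable_restrictT f (measurable_box2 delta xi)).1.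
  apply/measurable_EFinP; apply: (measurable_funS measurableT) => //.
  by apply: measurable_sum => p; exact: measurable_cos_affine2.
rewrite integral_mkcond fubini_tonelli1; last 2 first.
- exact: mf.
- by move=> x; rewrite patchE; case: ifP => // _; rewrite lee_fin.
rewrite -(integral_sum_cos_affine _ (fun p => sinc_weight delta (be p)) al
  (fun p => be p * (xi.2 + delta / 2)))//.
rewrite [RHS]integral_mkcond; apply: eq_integral => x _.
rewrite /fubini_F [RHS]patchE; case: ifPn => xA; last first.
  rewrite integral0_eq// => y _; rewrite patchE; case: ifPn => //.
  by rewrite in_setE => -[/= xA1 _]; case/negP: xA; rewrite in_setE.
transitivity (\int[lebesgue_measure]_(y in `[xi.2, (xi.2 + delta)%R])
   (\sum_p 1 * cos (be p * y + al p * x))%:E)%E.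
  rewrite [RHS]integral_mkcond; apply: eq_integral => y _.
  rewrite !patchE/=.
  have -> : ((x, y) \in box2 delta xi) = (y \in `[xi.2, (xi.2 + delta)%R]%classic).
    by rewrite /box2 in_setX/= xA.
  by case: ifP => // _; under [in RHS]eq_bigr do rewrite mul1r addrC.
rewrite integral_sum_cos_affine//.
by under eq_bigr do rewrite mul1r addrC.
Qed.

(** * Even powers of the Weyl sum as cosine sums *)

Lemma cexpiD {R : realType} (a b : R) : cexpi (a + b) = cexpi a * cexpi b.
Proof. by rewrite /cexpi cosD sinD; simpc; rewrite [sin a * _ + _]addrC. Qed.

Lemma sqr_norm_sum_cexpi {R : realType} (I : finType) (th : I -> R) :
  (complex.Re `|\sum_i cexpi (th i)|) ^+ 2 =
  \sum_(p : I * I) cos (th p.1 - th p.2).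
Proof.
rewrite normc_def/= sqr_sqrtr ?addr_ge0 ?sqr_ge0//.
have -> : complex.Re (\sum_i cexpi (th i)) = \sum_i cos (th i).
  by rewrite raddf_sum.
have -> : complex.Im (\sum_i cexpi (th i)) = \sum_i sin (th i).
  by rewrite raddf_sum.
rewrite !expr2 !big_distrlr/= -big_split/= -(pair_bigA _ (fun i j => cos (th i - th j)))/=.
apply: eq_bigr => i _; rewrite -big_split/=; apply: eq_bigr => j _.
by rewrite cosB.
Qed.

Lemma sum_cexpi_cube {R : realType} (I : finType) (th : I -> R) :
  (\sum_i cexpi (th i)) ^+ 3 =
  \sum_(t : I * I * I) cexpi (th t.1.1 + th t.1.2 + th t.2).
Proof.
rewrite -(pair_bigA _ (fun i j => cexpi (th i.1 + th i.2 + th j)))/=.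
rewrite -(pair_bigA _ (fun i i' => \sum_j cexpi (th i + th i' + th j)))/=.
rewrite exprS expr2 mulrA big_distrlr/= mulr_suml.
apply: eq_bigr => i _; rewrite mulr_suml; apply: eq_bigr => j _.
by rewrite mulr_sumr; apply: eq_bigr => k _; rewrite !cexpiD.
Qed.

Lemma weyl_sum2E {R : realType} (x : R * R) (N : nat) :
  weyl_sum [tuple x.1; x.2] N =
  \sum_(i < N) cexpi (2 * pi * (x.1 * i.+1%:R + x.2 * i.+1%:R ^+ 2)).
Proof.
rewrite /weyl_sum big_add1/= big_mkord; apply: eq_bigr => i _.
by rewrite !big_ord_recl big_ord0 addr0 /= expr1.
Qed.

Lemma weyl_abs_ge0 {R : realType} (x : R * R) (N : nat) :
  0 <= weyl_abs [tuple x.1; x.2] N.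
Proof. by rewrite /weyl_abs normc_def/= sqrtr_ge0. Qed.

Lemma weyl_abs_sqr {R : realType} (x : R * R) (N : nat) :
  weyl_abs [tuple x.1; x.2] N ^+ 2 =
  \sum_(p : 'I_N * 'I_N)
     cos (2 * pi * (p.1.+1%:R - p.2.+1%:R) * x.1
          + 2 * pi * (p.1.+1%:R ^+ 2 - p.2.+1%:R ^+ 2) * x.2).
Proof.
rewrite /weyl_abs weyl_sum2E sqr_norm_sum_cexpi.
by apply: eq_bigr => p _; congr cos; ring.
Qed.

(* [i : 'I_N] stands for the integer [i + 1] of [1, N]. *)
Definition triple_sum (N : nat) (e : nat) (t : 'I_N * 'I_N * 'I_N) : nat :=
  (t.1.1.+1 ^ e + t.1.2.+1 ^ e + t.2.+1 ^ e)%N.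

(** Since |S|^6 = |S^3|^2 and S^3 is again a sum of [cexpi], now over triples, the formula for the
    square applies. *)
Lemma weyl_abs_pow6 {R : realType} (x : R * R) (N : nat) :
  weyl_abs [tuple x.1; x.2] N ^+ 6 =
  \sum_(p : ('I_N * 'I_N * 'I_N) * ('I_N * 'I_N * 'I_N))
     cos (2 * pi * ((triple_sum N 1 p.1)%:R - (triple_sum N 1 p.2)%:R) * x.1
          + 2 * pi * ((triple_sum N 2 p.1)%:R - (triple_sum N 2 p.2)%:R) * x.2).
Proof.
have -> : weyl_abs [tuple x.1; x.2] N ^+ 6 =
    (complex.Re `|weyl_sum [tuple x.1; x.2] N ^+ 3|) ^+ 2.
  rewrite normrX /weyl_abs normc_def -rmorphXn/=.
  by rewrite -exprM.
rewrite weyl_sum2E sum_cexpi_cube sqr_norm_sum_cexpi.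
by apply: eq_bigr => p _; rewrite /triple_sum !natrD !natrX; congr cos; ring.
Qed.

Lemma weyl_abs_le {R : realType} (x : R * R) (N : nat) :
  weyl_abs [tuple x.1; x.2] N <= N%:R.
Proof.
rewrite -(@ler_pXn2r _ 2) ?nnegrE ?weyl_abs_ge0// weyl_abs_sqr.
apply: (le_trans (y := \sum_(p : 'I_N * 'I_N) 1)).
  by apply: ler_sum => p _; exact: cos_le1.
by rewrite sumr_const card_prod !card_ord natrM -expr2.
Qed.

(** The modulus is the square root of its square, which is a finite sum of cosines. *)
Lemma measurable_weyl_abs {R : realType} (N : nat) :
  measurable_fun [set: R * R] (fun x : R * R => weyl_abs [tuple x.1; x.2] N).
Proof.
have -> : (fun x : R * R => weyl_abs [tuple x.1; x.2] N) =
    (fun x : R * R => (weyl_abs [tuple x.1; x.2] N ^+ 2) `^ 2^-1).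
  by apply/funext => x; rewrite -powR_mulrn ?weyl_abs_ge0// -powRrM divff// powRr1 ?weyl_abs_ge0.
apply: (measurableT_comp (measurable_powR _)).
under [X in measurable_fun _ X]eq_fun do rewrite weyl_abs_sqr.
by apply: measurable_sum => p; exact: measurable_cos_affine2.
Qed.

(** * Parametrisation of a b = c d *)

(** With g = gcd(a, c), the quotients x = a / g and y = c / g are coprime, so y divides b and x
    divides d. The choice z = gcd(b, d) is the common cofactor, and stays correct when x or y is
    0. *)
Lemma eq_mul_decompose (N a b c d : nat) :
  (a <= N)%N -> (b <= N)%N -> (c <= N)%N -> (d <= N)%N -> (a * b = c * d)%N ->
  exists g x y z : nat, [/\ (g <= N)%N, (x <= N)%N, (y <= N)%N & (z <= N)%N] /\
    [/\ a = (g * x)%N, b = (y * z)%N, c = (g * y)%N & d = (x * z)%N].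
Proof.
move=> aN bN cN dN abcd.
have gcd_le (m n : nat) : (m <= N)%N -> (n <= N)%N -> (gcdn m n <= N)%N.
  move=> mN nN; case: m mN => [|m] mN; first by rewrite gcd0n.
  by apply: leq_trans mN; rewrite dvdn_leq// dvdn_gcdl.
have div_le (m n : nat) : (m <= N)%N -> (m %/ n <= N)%N.
  by move=> mN; apply: leq_trans (leq_div _ _) mN.
have [g0|g_gt0] := posnP (gcdn a c).
  have /norP[] : ~~ ((0 < a) || (0 < c))%N by rewrite -gcdn_gt0 g0.
  rewrite -!eqn0Ngt => /eqP a0 /eqP c0.
  (* Here a = c = 0. If b = d = 0 as well, the quotients by 0 are 0 and the equations still hold. *)
  exists 0%N, (d %/ gcdn b d)%N, (b %/ gcdn b d)%N, (gcdn b d).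
  split; first by split; rewrite ?div_le ?gcd_le.
  by split; rewrite ?mul0n// divnK// ?dvdn_gcdl ?dvdn_gcdr.
have ea : a = (gcdn a c * (a %/ gcdn a c))%N by rewrite mulnC divnK ?dvdn_gcdl.
have ec : c = (gcdn a c * (c %/ gcdn a c))%N by rewrite mulnC divnK ?dvdn_gcdr.
have cop : coprime (a %/ gcdn a c) (c %/ gcdn a c).
  rewrite /coprime -(eqn_pmul2l g_gt0) muln1 muln_gcdr -ea -ec.
  done.
move: cop ea ec; set x := (a %/ _)%N; set y := (c %/ _)%N => cop ea ec.
have xbyd : (x * b = y * d)%N.
  by apply/eqP; rewrite -(eqn_pmul2l g_gt0) !mulnA -ea -ec abcd.
have yb : (y %| b)%N.
  by rewrite -(Gauss_dvdr b (m:=y) (n:=x)) ?xbyd ?dvdn_mulr// coprime_sym.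
have xd : (x %| d)%N.
  by rewrite -(Gauss_dvdr d (m:=x) (n:=y))// -xbyd dvdn_mulr.
exists (gcdn a c), x, y, (gcdn b d).
have gxy : gcdn x y = 1%N by apply/eqP.
split; first by split; rewrite ?div_le ?gcd_le.
case/dvdnP: yb => z bE; case/dvdnP: xd => z' dE.
split=> //.
  have [y0|ygt] := posnP y.
    by rewrite bE y0 muln0 mul0n.
  (* Write b = z y and d = z' x. Cancelling y in x b = y d gives d = x z, whence gcd(b, d) = z
     gcd(x, y) = z. *)
  suff : gcdn b d = z by move=> ->; rewrite mulnC.
  have : (y * (x * z) = y * (x * z'))%N by move: xbyd; rewrite bE dE; nia.
  move/eqP; rewrite eqn_pmul2l// => /eqP xx.
  by rewrite bE dE -[(z' * x)%N]mulnC -xx [(x * z)%N]mulnC -muln_gcdr gcdnC gxy muln1.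
have [x0|xgt] := posnP x.
  by rewrite dE x0 muln0 mul0n.
suff : gcdn b d = z' by move=> ->; rewrite mulnC.
have : (x * (y * z) = x * (y * z'))%N by move: xbyd; rewrite bE dE; nia.
move/eqP; rewrite eqn_pmul2l// => /eqP xx.
by rewrite bE dE [(z * y)%N]mulnC xx [(y * z')%N]mulnC -muln_gcdr gcdnC gxy muln1.
Qed.

(** * Bounds for the weights and the second moment *)

Lemma sinc_weight0 {R : realType} (delta : R) : sinc_weight delta 0 = delta.
Proof. by rewrite /sinc_weight eqxx. Qed.

Lemma sinc_weight_le {R : realType} (delta c : R) : c != 0 ->
  `|sinc_weight delta c| <= 2 / `|c|.
Proof.
move=> c0; rewrite /sinc_weight (negbTE c0) normrM normfV ler_pM2r ?invr_gt0 ?normr_gt0//.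
by rewrite normrM ger0_norm// ler_piMr// ler_norml sin_geN1 sin_le1.
Qed.

Lemma sin_natpi {R : realType} (n : nat) : sin (n%:R * pi) = 0 :> R.
Proof.
elim: n => [|n IH]; first by rewrite mul0r sin0.
by rewrite -natr1 mulrDl mul1r sinD IH sinpi mul0r mulr0 addr0.
Qed.

(** Orthogonality of characters over a full period. *)
Lemma sinc_weight_int {R : realType} (a b : nat) : a != b ->
  sinc_weight 1 (2 * pi * (a%:R - b%:R)) = 0 :> R.
Proof.
move=> ab; rewrite /sinc_weight.
have pi0 : pi != 0 :> R by rewrite gt_eqF ?pi_gt0.
rewrite !mulf_eq0 pnatr_eq0/= (negbTE pi0) subr_eq0 eqr_nat (negbTE ab)/=.
rewrite (_ : 2 * pi * (a%:R - b%:R) * (1 / 2) = a%:R * pi - b%:R * pi); last by field.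
by rewrite sinB !sin_natpi mul0r mulr0 subr0 mulr0 mul0r.
Qed.

Definition harmonic_sum {R : realType} (N : nat) : R := \sum_(i < N) i.+1%:R^-1.

Lemma harmonic_sum_ge0 {R : realType} (N : nat) : 0 <= harmonic_sum N :> R.
Proof. by apply: sumr_ge0 => i _; rewrite invr_ge0. Qed.

Lemma sum_inv_sub_le {R : realType} (N : nat) (n : 'I_N) :
  \sum_(m < N | (m < n)%N) (n - m)%:R^-1 <= harmonic_sum N :> R.
Proof.
rewrite -(big_ord_widen N (fun m => (n - m)%:R^-1)) 1?ltnW//.
rewrite (reindex_inj rev_ord_inj)/= /harmonic_sum.
under eq_bigr do rewrite subKn//.
rewrite (big_ord_widen N (fun i => i.+1%:R^-1)) 1?ltnW//.
by rewrite [leRHS](bigID (fun i : 'I_N => (i < n)%N))/= lerDl sumr_ge0.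
Qed.

(** Each side of [n] contributes part of a harmonic sum; the reflection [rev_ord] carries the side
    [m > n] to the side [m < n]. *)
Lemma sum_inv_dist_le {R : realType} (N : nat) (n : 'I_N) :
  \sum_(m < N | m != n) `|n.+1%:R - m.+1%:R|^-1 <= 2 * harmonic_sum N :> R.
Proof.
rewrite (bigID (fun m : 'I_N => (m < n)%N))/= mulr_natl mulr2n; apply: lerD.
  apply: le_trans (sum_inv_sub_le N n); rewrite le_eqVlt; apply/orP; left; apply/eqP.
  apply: eq_big => [m|m /andP[_ mn]].
    by rewrite andb_idl// => mn; apply: contraTneq mn => ->; rewrite ltnn.
  by rewrite -[in LHS]natrB ?ltnS 1?ltnW// subSS ger0_norm.
apply: le_trans (sum_inv_sub_le N (rev_ord n)).
rewrite [leRHS](reindex_inj rev_ord_inj)/=.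
rewrite le_eqVlt; apply/orP; left; apply/eqP.
apply: eq_big => [m|m /andP[mn1 mn2]].
  rewrite -val_eqE/=; have := ltn_ord m; have := ltn_ord n; lia.
have mn : (n < m)%N by rewrite ltn_neqAle eq_sym mn1 leqNgt.
rewrite distrC -[in LHS]natrB ?ltnS 1?ltnW// subSS ger0_norm//.
congr (_%:R^-1); have := ltn_ord m; have := ltn_ord n; lia.
Qed.

(** Off the diagonal the quadratic frequency has weight at most 1 / n and the linear one at most 1 /
    |n - m|. Summing over m, then over n, gives one harmonic factor each. *)
Lemma second_moment_box {R : realType} (delta : R) (xi : R * R) (N : nat) :
  0 < delta ->
  (\int[(@lebesgue_measure R \x @lebesgue_measure R)%E]_(x in box2 delta xi)
     (weyl_abs [tuple x.1; x.2] N ^+ 2)%:E <=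
   (delta ^+ 2 * N%:R + 2 * harmonic_sum N ^+ 2)%:E)%E.
Proof.
move=> d0; under eq_integral do rewrite weyl_abs_sqr.
rewrite integral_box2_sum_cos//; last by move=> x; rewrite -weyl_abs_sqr sqr_ge0.
rewrite lee_fin.
rewrite -(pair_bigA _ (fun n m : 'I_N =>
  sinc_weight delta (2 * pi * (n.+1%:R ^+ 2 - m.+1%:R ^+ 2)) *
  (sinc_weight delta (2 * pi * (n.+1%:R - m.+1%:R)) *
   cos (2 * pi * (n.+1%:R - m.+1%:R) * (xi.1 + delta / 2) +
        2 * pi * (n.+1%:R ^+ 2 - m.+1%:R ^+ 2) * (xi.2 + delta / 2)))))/=.
apply: (le_trans (y := \sum_(n < N) (delta ^+ 2 + n.+1%:R^-1 * (2 * harmonic_sum N)))); last first.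
  rewrite big_split/= sumr_const card_ord -mulr_suml -/(harmonic_sum N) mulr_natr.
  by rewrite lerD2l expr2 mulrCA.
apply: ler_sum => n _; rewrite (bigD1 n)//=; apply: lerD.
  by rewrite !subrr mulr0 sinc_weight0 !mul0r addr0 cos0 mulr1 expr2.
apply: le_trans (ler_wpM2l _ (sum_inv_dist_le N n)); last by rewrite invr_ge0.
rewrite mulr_sumr; apply: ler_sum => m mn.
apply: (le_trans (ler_norm _)); rewrite !normrM.
have nm0 : (n.+1%:R - m.+1%:R : R) != 0.
  by rewrite subr_eq0 eqr_nat eqSS eq_sym.
have nm1 : 1 <= `|n.+1%:R - m.+1%:R : R|.
  have [h|h] := ltnP m n.
    by rewrite -natrB ?ltnS 1?ltnW// subSS ger0_norm// ler1n subn_gt0.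
  have {}h : (n < m)%N by rewrite ltn_neqAle eq_sym mn.
  by rewrite distrC -natrB ?ltnS 1?ltnW// subSS ger0_norm// ler1n subn_gt0.
have pi2 := @pi_ge2 R.
have a0 : 2 * pi * (n.+1%:R - m.+1%:R) != 0 :> R.
  by rewrite !mulf_neq0// gt_eqF// pi_gt0.
have nm2 : (n.+1%:R ^+ 2 - m.+1%:R ^+ 2 : R) != 0.
  by rewrite subr_sqr mulf_neq0// -natrD.
have b0 : 2 * pi * (n.+1%:R ^+ 2 - m.+1%:R ^+ 2) != 0 :> R.
  by rewrite !mulf_neq0// gt_eqF// pi_gt0.
rewrite mulrA; apply: (le_trans (ler_piMr _ _)); first by rewrite mulr_ge0.
  by rewrite ler_norml cos_geN1 cos_le1.
apply: (le_trans (ler_pM _ _ (sinc_weight_le delta _ b0) (sinc_weight_le delta _ a0))) => //.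
have pi0 : 0 < pi :> R by exact: pi_gt0.
(* Uses |n^2 - m^2| = |n - m| (n + m) >= n, as distinct integers differ by at least 1. *)
have le1 : 2 / `|2 * pi * (n.+1%:R ^+ 2 - m.+1%:R ^+ 2)| <= n.+1%:R^-1 :> R.
  rewrite ler_pdivrMr ?normr_gt0// mulrC ler_pdivlMr ?ltr0n//.
  rewrite -mulrA normrM (ger0_norm (ler0n _ 2)) ler_pM2l// normrM (gtr0_norm pi0).
  rewrite subr_sqr normrM -natrD (ger0_norm (ler0n _ (n.+1 + m.+1)%N)).
  have h : n.+1%:R <= (n.+1 + m.+1)%:R :> R by rewrite ler_nat leq_addr.
  have h0 : 0 <= (n.+1 + m.+1)%:R :> R by [].
  apply: (le_trans h); rewrite mulrA -[leLHS]mul1r; apply: ler_wpM2r => //.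
  nra.
have le2 : 2 / `|2 * pi * (n.+1%:R - m.+1%:R)| <= `|n.+1%:R - m.+1%:R|^-1 :> R.
  rewrite normrM normrM (ger0_norm (ler0n _ 2)) (gtr0_norm pi0) invfM mulrA.
  by rewrite ler_piMl ?invr_ge0// ler_pdivrMr ?mulr_gt0// mul1r; nra.
by apply: ler_pM.
Qed.

(** * Counting solutions and the sixth moment *)

(* Zero coordinates are allowed, so that degenerate solutions of [a b = c d] need
   no separate treatment. *)
Definition hyperbola_pairs (N : nat) : {set 'I_N.+1 * 'I_N.+1} :=
  [set p : 'I_N.+1 * 'I_N.+1 | (p.1 * p.2 <= N)%N]%SET.

(** Row 0 has N + 1 points and row g >= 1 at most N / g + 1. The total N H + 2 N + 1 is at most N (H
    + 3) because N >= 1. *)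
Lemma card_hyperbola_pairs {R : realType} (N : nat) : (0 < N)%N ->
  #|hyperbola_pairs N|%:R <= N%:R * (harmonic_sum N + 3) :> R.
Proof.
move=> N0.
have -> : #|hyperbola_pairs N| = (\sum_(g < N.+1) #|[set x : 'I_N.+1 | (g * x <= N)%N]%SET|)%N.
  rewrite /hyperbola_pairs -sum1dep_card; under [in RHS]eq_bigr do rewrite -sum1dep_card.
  by rewrite pair_big_dep.
rewrite natr_sum big_ord_recl/=.
have le0 : (#|[set x : 'I_N.+1 | (0 * x <= N)%N]%SET|%:R : R) <= N%:R + 1.
  by rewrite natr1 ler_nat -[leqRHS]card_ord max_card.
apply: (le_trans (lerD le0 (_ : _ <= \sum_(i < N) (N%:R * i.+1%:R^-1 + 1)))).
  apply: ler_sum => i _.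
  apply: (le_trans (y := ((N %/ i.+1).+1)%:R)).
    rewrite ler_nat.
    have := leq_imset_card (fun x : 'I_(N %/ i.+1).+1 => inord x : 'I_N.+1) predT.
    rewrite card_ord; apply: leq_trans.
    apply: subset_leq_card; apply/fintype.subsetP => x; rewrite !inE => xN.
    have xl : (x < (N %/ i.+1).+1)%N by rewrite ltnS leq_divRL// mulnC.
    by apply/imsetP; exists (Ordinal xl) => //=; rewrite inord_val.
  rewrite -natr1 lerD2r ler_pdivlMr ?ltr0n// -natrM ler_nat.
  exact: leq_trunc_div.
rewrite big_split/= sumr_const card_ord -mulr_sumr -/(harmonic_sum N).
have : 1 <= N%:R :> R by rewrite ler1n.
lra.
Qed.

Definition vinogradov_solutions (N : nat) :
    {set ('I_N * 'I_N * 'I_N) * ('I_N * 'I_N * 'I_N)} :=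
  [set p | (triple_sum N 1 p.1 == triple_sum N 1 p.2) &&
           (triple_sum N 2 p.1 == triple_sum N 2 p.2)]%SET.

(** The factor 16 counts the signs of a, b, c, d and N counts [m3]. The pairs (g, x) and (y, z) lie
    under the hyperbola because g x = |a| and y z = |b|. Only surjectivity of the parametrisation is
    required. *)
Lemma card_vinogradov_solutions (N : nat) :
  (#|vinogradov_solutions N| <= 16 * N * #|hyperbola_pairs N| ^ 2)%N.
Proof.
(* [inord] needs an inhabited ordinal type, so the empty range is separate. *)
case: N => [|N].
  rewrite (_ : vinogradov_solutions 0 = finset.set0) ?cards0//.
  by apply/setP => -[[[[]]]].
pose sg (b : bool) (n : nat) : int := if b then - n%:Z else n%:Z.
(* [h] recovers a solution from [m3], the signs of [a], [b], [c], [d] and the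
   parameters [g], [x], [y], [z]. *)
pose h (q : 'I_N.+1 * ((bool * bool) * (bool * bool)) *
            (('I_N.+2 * 'I_N.+2) * ('I_N.+2 * 'I_N.+2))) :
    ('I_N.+1 * 'I_N.+1 * 'I_N.+1) * ('I_N.+1 * 'I_N.+1 * 'I_N.+1) :=
  let: (m3, ((s1, s2), (s3, s4)), ((g, x), (y, z))) := q in
  let a := sg s1 (g * x)%N in let b := sg s2 (y * z)%N in
  let c := sg s3 (g * y)%N in let d := sg s4 (x * z)%N in
  let n3 := a + b + m3%:Z - c - d in
  ((inord `|a + m3%:Z|, inord `|b + m3%:Z|, inord `|n3|),
   (inord `|c + n3|, inord `|d + n3|, m3)).
pose B := finset.setX (finset.setX [set: 'I_N.+1]%SET [set: (bool * bool) * (bool * bool)]%SET)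
  (finset.setX (hyperbola_pairs N.+1) (hyperbola_pairs N.+1)).
have -> : (16 * N.+1 * #|hyperbola_pairs N.+1| ^ 2 = #|B|)%N.
  by rewrite !cardsX !cardsT card_ord !card_prod card_bool; ring.
apply: leq_trans (leq_imset_card h _).
apply: subset_leq_card; apply/fintype.subsetP => -[[[n1 n2] n3] [[m1 m2] m3]].
rewrite inE /triple_sum/= => /andP[/eqP e1 /eqP e2].
pose a : int := n1%:Z - m3%:Z; pose b : int := n2%:Z - m3%:Z.
pose c : int := m1%:Z - n3%:Z; pose d : int := m2%:Z - n3%:Z.
have lin : a + b + m3%:Z = c + d + n3%:Z.
  by rewrite /a /b /c /d; lia.
(* Twice a b is (n1 + n2 - m3)^2 - (n1^2 + n2^2 - m3^2), and likewise for c d; both brackets agree.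
   The shift by one in [triple_sum] is harmless, the system being translation invariant. *)
have abcd : a * b = c * d.
  by rewrite /a /b /c /d; nia.
have absE (e : int) : e = sg (e < 0) `|e|%N.
  by rewrite /sg; case: ifP; lia.
have bnd (i j : 'I_N.+1) : (`|i%:Z - j%:Z| <= N.+1)%N.
  by have := ltn_ord i; have := ltn_ord j; lia.
have [g [x [y [z [[gN xN yN zN] [ea eb ec ed]]]]]] :=
  @eq_mul_decompose N.+1 `|a|%N `|b|%N `|c|%N `|d|%N (bnd _ _) (bnd _ _) (bnd _ _) (bnd _ _)
    (ltac:(by rewrite -!abszM abcd)).
apply/imsetP.
exists (m3, ((a < 0, b < 0), (c < 0, d < 0)),
  ((Ordinal (gN : (g < N.+2)%N), Ordinal (xN : (x < N.+2)%N)),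
   (Ordinal (yN : (y < N.+2)%N), Ordinal (zN : (z < N.+2)%N)))).
  by rewrite !inE/= -ea -eb; apply/andP; split; exact: bnd.
rewrite /h/= -ea -eb -ec -ed -!absE.
have -> : a + b + m3%:Z - c - d = n3%:Z by rewrite lin; ring.
have addK (i j : 'I_N.+1) : i = inord `|(i%:Z - j%:Z + j%:Z)%R|%N.
  by rewrite subrK absz_nat inord_val.
by rewrite /a /b /c /d -!addK absz_nat inord_val.
Qed.

(** By orthogonality only solutions of the system survive, each contributing a cosine, at most 1. *)
Lemma sixth_moment_box {R : realType} (xi : R * R) (N : nat) : (0 < N)%N ->
  (\int[(@lebesgue_measure R \x @lebesgue_measure R)%E]_(x in box2 1 xi)
     (weyl_abs [tuple x.1; x.2] N ^+ 6)%:E <=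
   (16 * N%:R ^+ 3 * (harmonic_sum N + 3) ^+ 2)%:E)%E.
Proof.
move=> N0; under eq_integral do rewrite weyl_abs_pow6.
rewrite integral_box2_sum_cos//; last first.
  by move=> x; rewrite -weyl_abs_pow6 exprn_ge0// weyl_abs_ge0.
rewrite lee_fin; apply: (le_trans (y := #|vinogradov_solutions N|%:R)).
  rewrite /vinogradov_solutions -sum1dep_card natr_sum [leRHS]big_mkcond/=; apply: ler_sum => p _.
  have [e2|ne2] := eqVneq (triple_sum N 2 p.1) (triple_sum N 2 p.2); last first.
    by rewrite (sinc_weight_int _ _ ne2) mul0r andbF.
  have [e1|ne1] := eqVneq (triple_sum N 1 p.1) (triple_sum N 1 p.2); last first.
    by rewrite (sinc_weight_int _ _ ne1) mul0r mulr0.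
  by rewrite e1 e2 !subrr mulr0 sinc_weight0 !mul1r cos_le1.
apply: (le_trans (y := (16 * N * #|hyperbola_pairs N| ^ 2)%:R)).
  by rewrite ler_nat card_vinogradov_solutions.
have := card_hyperbola_pairs (R := R) N N0.
rewrite !natrM; set D := #|_|%:R; set H := harmonic_sum N => DH.
have D0 : 0 <= D :> R by [].
have DH2 := ler_pM D0 D0 DH DH.
have -> : 16 * N%:R ^+ 3 * (H + 3) ^+ 2 = 16 * N%:R * (N%:R * (H + 3) * (N%:R * (H + 3))) by ring.
by rewrite ler_wpM2l// mulr_ge0.
Qed.

(** * Logarithmic losses are subpolynomial *)

(** Induction, with ln(1 - t) <= -t at t the reciprocal of the new integer. *)
Lemma harmonic_sum_le_ln {R : realType} (N : nat) : (0 < N)%N ->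
  harmonic_sum N <= 1 + ln N%:R :> R.
Proof.
case: N => // N _; elim: N => [|N IH].
  by rewrite /harmonic_sum big_ord1 ln1 addr0 invr1.
rewrite /harmonic_sum big_ord_recr/=.
suff h : N.+2%:R^-1 <= ln N.+2%:R - ln N.+1%:R :> R.
  by apply: (le_trans (lerD IH h)); lra.
have x0 : 0 < N.+2%:R :> R by rewrite ltr0n.
have y0 : 0 < N.+1%:R :> R by rewrite ltr0n.
have : ln (1 - N.+2%:R^-1) <= - N.+2%:R^-1 :> R.
  by apply: le_ln1Dx; rewrite ltrN2 invf_lt1 ?ltr1n.
have -> : 1 - N.+2%:R^-1 = N.+1%:R / N.+2%:R :> R.
  apply: (mulIf (x := N.+2%:R)); first by rewrite gt_eqF.
  by rewrite divfK ?gt_eqF// mulrBl mul1r mulVf ?gt_eqF// -[N.+2%:R]natr1 addrK.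
by rewrite ln_div ?posrE// lerNr opprB.
Qed.

(** The left side is exactly the total loss [1 + L] of the final estimate. *)
Lemma harmonic_sum_subpolynomial {R : realType} (eps : R) : 0 < eps ->
  exists N0 : nat, forall N : nat, (0 < N)%N -> (N0 <= N)%N ->
    1 + 16 * (harmonic_sum N + 3) ^+ 2 <= N%:R `^ eps.
Proof.
(* Two quarters of [eps] pay for the squared logarithm, the other two for the constant [M]. In [K],
   4 = 1 + 3 and [e^-1] comes from ln X <= X^e / e. *)
move=> eps0; pose e := eps / 4; have e0 : 0 < e by rewrite /e; lra.
pose K := 4 + e^-1; pose M := 1 + 16 * K ^+ 2.
have ei0 : 0 < e^-1 by rewrite invr_gt0.
have M0 : 0 <= M by rewrite /M addr_ge0// mulr_ge0// sqr_ge0.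
exists (Num.trunc (M `^ (2 * e)^-1)).+1 => N N0 NM.
have X1 : 1 <= N%:R :> R by rewrite ler1n.
have X0 : 0 < N%:R :> R by rewrite ltr0n.
set X : R := N%:R in X1 X0 *.
have Xe1 : 1 <= X `^ e by rewrite -(powRr0 X); apply: ler_powR => //; exact: ltW.
have lnX : ln X <= X `^ e / e.
  rewrite ler_pdivlMr// mulrC -ln_powR.
  have := @le_ln1Dx R (X `^ e - 1); rewrite [1 + _]addrC subrK => h.
  by apply: (le_trans (h _)); lra.
have HX : harmonic_sum N + 3 <= K * X `^ e.
  have := harmonic_sum_le_ln (R := R) N N0; rewrite -/X /K; nra.
have H0 := harmonic_sum_ge0 (R := R) N.
have MX : M <= X `^ (2 * e).
  have -> : M = (M `^ (2 * e)^-1) `^ (2 * e).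
    by rewrite -powRrM mulVf ?powRr1// gt_eqF// mulr_gt0.
  apply: ge0_ler_powR; rewrite ?nnegrE ?powR_ge0//.
  - by rewrite mulr_ge0// ltW.
  - apply: (le_trans (ltW (truncnS_gt _))); rewrite /X ler_nat; exact: NM.
have -> : eps = 2 * e + 2 * e by rewrite /e; field.
rewrite powRD; last by rewrite (gt_eqF X0) implybT.
have X2e : X `^ (2 * e) = X `^ e ^+ 2.
  by rewrite mulrC powRrM powR_mulrn// powR_ge0.
apply: (le_trans (y := M * X `^ (2 * e))); last by rewrite ler_wpM2r// powR_ge0.
rewrite X2e /M; set H := harmonic_sum N in H0 HX *; set Y := X `^ e in HX Xe1 *.
have : (H + 3) ^+ 2 <= (K * Y) ^+ 2 by rewrite ler_pXn2r ?nnegrE//; lra.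
have : 1 <= Y ^+ 2 by rewrite exprn_ege1.
by rewrite exprMn; lra.
Qed.

(** * From integer moments to real exponents *)

(** The first term suffices if a <= T. Otherwise a / T > 1, and raising the exponent of a / T from r
    to k gives the second. *)
Lemma powR_le_threshold {R : realType} (a T r : R) (k : nat) :
  0 <= a -> 0 < T -> 0 <= r -> r <= k%:R ->
  a `^ r <= T `^ r + T `^ (r - k%:R) * a ^+ k.
Proof.
move=> a0 T0 r0 rk; have [aT|Ta] := leP a T.
  rewrite -[leLHS]addr0 lerD ?mulr_ge0 ?powR_ge0 ?exprn_ge0//.
  by apply: ge0_ler_powR; rewrite ?nnegrE// ltW.
rewrite -[leLHS]add0r lerD ?powR_ge0//.
have -> : a = T * (a / T) by rewrite mulrC divfK// gt_eqF.
have aT0 : 0 <= a / T by rewrite divr_ge0// ltW.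
rewrite powRM ?(ltW T0)// exprMn mulrA -[T ^+ k]powR_mulrn ?(ltW T0)//.
rewrite -powRD ?subrK; last by rewrite (gt_eqF T0) implybT.
rewrite ler_wpM2l ?powR_ge0// -powR_mulrn//.
by apply: ler_powR => //; rewrite ler_pdivlMr// mul1r ltW.
Qed.

Lemma lebesgue_measure_box2 {R : realType} (delta : R) (xi : R * R) : 0 < delta ->
  (@lebesgue_measure R \x @lebesgue_measure R)%E (box2 delta xi) =
  (delta ^+ 2)%:E.
Proof.
move=> d0; rewrite /box2 product_measure1E//=.
rewrite !lebesgue_measure_itv/= !lte_fin !ltrDl d0.
by rewrite -!EFinD -EFinM ![_ + delta]addrC !addrK expr2.
Qed.

Lemma measurable_weyl_abs_powR {R : realType} (D : set (R * R)) (N : nat) (r : R) :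
  measurable_fun D (fun x : R * R => (weyl_abs [tuple x.1; x.2] N `^ r)%:E).
Proof.
apply/measurable_EFinP; apply: (measurable_funS measurableT) => //.
exact: (measurableT_comp (measurable_powR _) (measurable_weyl_abs N)).
Qed.

Lemma measurable_weyl_abs_exprn {R : realType} (D : set (R * R)) (N k : nat) :
  measurable_fun D (fun x : R * R => (weyl_abs [tuple x.1; x.2] N ^+ k)%:E).
Proof.
under eq_fun do rewrite -powR_mulrn ?weyl_abs_ge0//.
exact: measurable_weyl_abs_powR.
Qed.

(** The term T^(2 s) is integrated over an area delta^2; in the other, T^(2 s - k) turns the T^k of
    the moment bound into T^(2 s). *)
Lemma local_mean_value2_threshold {R : realType} (s delta T L : R) (xi : R * R)
    (N k : nat) :
  0 < s -> 0 < delta -> 0 < T -> 2 * s <= k%:R ->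
  (\int[(@lebesgue_measure R \x @lebesgue_measure R)%E]_(x in box2 delta xi)
     (weyl_abs [tuple x.1; x.2] N ^+ k)%:E <= (L * (delta ^+ 2 * T ^+ k))%:E)%E ->
  (local_mean_value2 s delta xi N <= (delta ^+ 2 * T `^ (2 * s) * (1 + L))%:E)%E.
Proof.
move=> s0 d0 T0 sk Ik; rewrite /local_mean_value2.
have mB := measurable_box2 delta xi.
apply: (@le_trans _ _ (\int[(@lebesgue_measure R \x @lebesgue_measure R)%E]_(x in box2 delta xi)
   ((T `^ (2 * s))%:E + (T `^ (2 * s - k%:R))%:E * (weyl_abs [tuple x.1; x.2] N ^+ k)%:E))%E).
  apply: ge0_le_integral => //.
  - by move=> x _; rewrite lee_fin powR_ge0.
  - exact: measurable_weyl_abs_powR.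
  - apply: emeasurable_funD => //; apply: emeasurable_funM => //.
    exact: measurable_weyl_abs_exprn.
  - move=> x _; rewrite -EFinM -EFinD lee_fin powR_le_threshold ?weyl_abs_ge0//.
    by rewrite mulr_ge0// ltW.
rewrite ge0_integralD//; last 3 first.
- by move=> x _; rewrite lee_fin powR_ge0.
- by move=> x _; rewrite -EFinM lee_fin mulr_ge0 ?powR_ge0// exprn_ge0// weyl_abs_ge0.
- by apply: emeasurable_funM => //; exact: measurable_weyl_abs_exprn.
rewrite integral_cst// [X in (_ * X + _)%E](lebesgue_measure_box2 delta xi d0).
rewrite ge0_integralZl//; last 3 first.
- exact: measurable_weyl_abs_exprn.
- by move=> x _; rewrite lee_fin exprn_ge0// weyl_abs_ge0.
- by rewrite lee_fin powR_ge0.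
apply: (le_trans (leeD2l _ (lee_wpmul2l _ Ik))); first by rewrite lee_fin powR_ge0.
rewrite -!EFinM -EFinD lee_fin.
rewrite mulrDr mulr1 [T `^ (2 * s) * _]mulrC lerD2l.
have -> : T `^ (2 * s) = T `^ (2 * s - k%:R) * T ^+ k.
  rewrite -powR_mulrn ?(ltW T0)// -powRD ?subrK//.
  by rewrite (gt_eqF T0) implybT.
by rewrite le_eqVlt; apply/orP; left; apply/eqP; ring.
Qed.

Lemma local_mean_value2_trivial {R : realType} (s delta M : R) (xi : R * R)
    (N k : nat) : (0 < N)%N -> k%:R <= 2 * s ->
  (\int[(@lebesgue_measure R \x @lebesgue_measure R)%E]_(x in box2 delta xi)
     (weyl_abs [tuple x.1; x.2] N ^+ k)%:E <= M%:E)%E ->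
  (local_mean_value2 s delta xi N <= (N%:R `^ (2 * s - k%:R) * M)%:E)%E.
Proof.
move=> N0 ks Ik; rewrite /local_mean_value2.
have mB := measurable_box2 delta xi.
rewrite EFinM; apply: le_trans (lee_wpmul2l _ Ik); last by rewrite lee_fin powR_ge0.
rewrite -ge0_integralZl//; last 2 first.
- exact: measurable_weyl_abs_exprn.
- by move=> x _; rewrite lee_fin exprn_ge0// weyl_abs_ge0.
apply: ge0_le_integral => //.
- by move=> x _; rewrite lee_fin powR_ge0.
- exact: measurable_weyl_abs_powR.
- by apply: emeasurable_funM => //; exact: measurable_weyl_abs_exprn.
move=> x _; rewrite -EFinM lee_fin.
have a0 := weyl_abs_ge0 x N; have aN := weyl_abs_le x N.
set a := weyl_abs _ _ in a0 aN *; rewrite -powR_mulrn//.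
(* A zero base is separate, since [powR] gives 0 at a nonzero exponent but 1 at exponent 0;
   [2 * s = 0] forces [k = 0]. *)
have [a00|an0] := eqVneq a 0.
  have [s0|s0] := eqVneq (2 * s) 0; last by rewrite a00 powR0// mulr_ge0 ?powR_ge0.
  have -> : k%:R = 0 :> R by apply/eqP; rewrite eq_le ler0n andbT -s0.
  by rewrite s0 subr0 !powRr0 mulr1.
rewrite -[X in a `^ X](subrK k%:R) powRD ?an0 ?implybT//.
rewrite ler_wpM2r ?powR_ge0//; apply: ge0_ler_powR; rewrite ?nnegrE//.
by rewrite subr_ge0.
Qed.

(** Enlarges the box to side 1. The bound does not shrink with [delta], but for s > 1 it will still
    be of the order wanted, as delta^2 T^6 >= N^3. *)
Lemma sixth_moment_small_box {R : realType} (delta : R) (xi : R * R) (N : nat) :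
  (0 < N)%N -> delta <= 1 ->
  (\int[(@lebesgue_measure R \x @lebesgue_measure R)%E]_(x in box2 delta xi)
     (weyl_abs [tuple x.1; x.2] N ^+ 6)%:E <=
   (16 * N%:R ^+ 3 * (harmonic_sum N + 3) ^+ 2)%:E)%E.
Proof.
move=> N0 d1; apply: le_trans (sixth_moment_box xi N N0).
apply: ge0_subset_integral; try exact: measurable_box2.
- exact: measurable_weyl_abs_exprn.
- by move=> x _; rewrite lee_fin exprn_ge0// weyl_abs_ge0.
- move=> x [/=]; rewrite !in_itv/= => /andP[h1 h2] /andP[h3 h4].
  by split => /=; rewrite in_itv/= ?h1 ?h3/=; lra.
Qed.

(** * The three ranges of s and the comparison of exponents *)

Theorem theorem3p7 (R : realType) (s : R) (hs : 0 < s) (eps : R) (heps : 0 < eps) :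
  exists N0 : nat, forall N : nat, (1 <= N)%N -> (N0 <= N)%N ->
    forall delta : R, (N%:R : R) `^ (- (3 / (6 + 2 * s))) <= delta -> delta <= 1 ->
    (sup_mean_value2 s delta N
       <= (delta ^+ 2 * (N%:R : R) `^ (2 * s * (1 - 3 / (6 + 2 * s)) + eps))%:E)%E.
Proof.
have [N0 hN0] := harmonic_sum_subpolynomial eps heps.
exists N0 => N N1 NN0 delta dge dle1.
have := hN0 N N1 NN0.
have X1 : 1 <= N%:R :> R by rewrite ler1n.
have X0 : 0 < N%:R :> R by rewrite ltr0n.
have H0 := harmonic_sum_ge0 (R := R) N.
set X : R := N%:R in X1 X0 dge *.
set H : R := harmonic_sum N in H0 *.
set L := 16 * (H + 3) ^+ 2 => LX.
have L0 : 0 <= L by rewrite /L mulr_ge0// sqr_ge0.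
set eta := 3 / (6 + 2 * s) in dge *.
have eta0 : 0 < eta by rewrite divr_gt0//; lra.
have etaE : eta * (6 + 2 * s) = 3 by rewrite divfK// gt_eqF//; lra.
have d0 : 0 < delta by apply: lt_le_trans dge; rewrite powR_gt0.
have Xadd (a b : R) : X `^ (a + b) = X `^ a * X `^ b.
  by rewrite powRD// (gt_eqF X0) implybT.
have Xle (a b : R) : a <= b -> X `^ a <= X `^ b by move=> ab; exact: ler_powR.
have dX : X `^ (- (2 * eta)) <= delta ^+ 2.
  rewrite (_ : - (2 * eta) = - eta * 2%:R); last by ring.
  by rewrite powRrM powR_mulrn ?powR_ge0// ler_pXn2r ?nnegrE ?powR_ge0// ltW.
(* Trades delta^2 for X^(-2 eta), so that what remains is to compare exponents of X. *)
have dXM (a : R) : X `^ (a - 2 * eta) <= delta ^+ 2 * X `^ a.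
  by rewrite addrC Xadd ler_wpM2r ?powR_ge0.
set T := X `^ (1 - eta).
have T0 : 0 < T by rewrite powR_gt0.
have Tk (k : nat) : T ^+ k = X `^ ((1 - eta) * k%:R).
  by rewrite powRrM powR_mulrn ?powR_ge0.
have TE : X `^ (2 * s * (1 - eta)) = T `^ (2 * s) by rewrite /T -powRrM [RHS]/= (mulrC (1 - eta)).
apply: ge_ereal_sup => _ [xi _ <-].
rewrite Xadd TE.
suff : (local_mean_value2 s delta xi N <= (delta ^+ 2 * T `^ (2 * s) * (1 + L))%:E)%E.
  move=> /le_trans; apply; rewrite lee_fin mulrA ler_wpM2l//.
  by rewrite mulr_ge0 ?sqr_ge0 ?powR_ge0.
have [s1|s1] := leP s 1.
  apply: (@local_mean_value2_threshold _ _ _ _ _ _ _ 2) => //; first by lra.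
  apply: (le_trans (second_moment_box delta xi N d0)); rewrite lee_fin -/X -/H Tk.
  (* Amounts to 2 eta <= 1, which follows from s > 0. *)
  have dN1 : 1 <= delta ^+ 2 * X.
    have := dXM 1; rewrite powRr1 ?(ltW X0)//; apply: le_trans.
    by rewrite -{1}(powRr0 X); apply: Xle; nra.
  have XT : X <= X `^ ((1 - eta) * 2).
    by rewrite -[leLHS]powRr1 ?(ltW X0)//; apply: Xle; nra.
  have dd : delta ^+ 2 * X <= delta ^+ 2 * X `^ ((1 - eta) * 2).
    by rewrite ler_wpM2l ?sqr_ge0.
  (* As delta^2 X >= 1, it is enough that 1 + 2 H^2 <= L = 16 (H + 3)^2. *)
  apply: (le_trans (y := L * (delta ^+ 2 * X))); last by rewrite ler_wpM2l.
  by rewrite /L; nra.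
have I6 := sixth_moment_small_box delta xi N N1 dle1.
have [s3|s3] := leP s 3.
  apply: (@local_mean_value2_threshold _ _ _ _ _ _ _ 6) => //; first by lra.
  apply: (le_trans I6); rewrite lee_fin -/X -/H Tk.
  rewrite (_ : 16 * _ * _ = L * X ^+ 3); last by rewrite /L; ring.
  rewrite ler_wpM2l//; apply: le_trans (dXM _).
  (* The inequality 3 <= 6 (1 - eta) - 2 eta says eta <= 3 / 8, that is, s >= 1. *)
  by rewrite -powR_mulrn ?(ltW X0)//; apply: Xle; nra.
apply: (le_trans (local_mean_value2_trivial s delta _ xi N 6 N1 _ I6)); first by lra.
rewrite lee_fin -/X -/H.
rewrite (_ : 16 * _ * _ = X ^+ 3 * L); last by rewrite /L; ring.
rewrite mulrA ler_pM//; [by rewrite mulr_ge0 ?powR_ge0 ?exprn_ge0 // ltW| |by rewrite lerDr].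
rewrite -powR_mulrn ?(ltW X0)// -Xadd -TE; apply: le_trans (dXM _).
(* The inequality 2 s - 3 <= 2 s (1 - eta) - 2 eta reads eta (2 s + 2) <= 3 = eta (6 + 2 s). *)
by apply: Xle; nra.
Qed.
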